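(* Let $n\ge0$ be an integer, $\beta$ a complex number, and $H_n^\beta=F_nE^{n\beta}F_n^{-1}$ acting on the space $\mathcal P_n$ of complex polynomials of degree at most $n$. Then $$H_n^{-\beta}=J_n\,H_n^\beta\,J_n ,$$ where $J_n$ is the operator $x^p\mapsto x^{n-p}$ on $\mathcal P_n$.
   Context: $F_n$ is the linear operator on $\mathcal P_n$ with $F_n x^p=(1-x)^{2n+1}\sum_{m\ge0}m^p\binom{m+n}{n}x^m$, $p=0,\dots,n$ (a polynomial of degree $\le n$; $0^0=1$); it is invertible with $F_n^{-1}x^p=\frac{n!}{(2n)!}(x)_p[x+n+1]_{n-p}$ (falling and rising factorials). $E^{c}$ is the shift $f(x)\mapsto f(x+c)$. *)

(* Defs.v *)
From HB Require Import structures.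
From mathcomp Require Import all_boot all_order all_algebra.
From mathcomp Require Import zify.

Set Implicit Arguments.
Unset Strict Implicit.
Unset Printing Implicit Defensive.

Import Order.TTheory GRing.Theory Num.Theory.
Local Open Scope ring_scope.

(* The space P_n of polynomials of degree at most n, i.e. of size at most n+1. *)
Notation Pn n K := (npoly K n.+1).

Section Operators.
Variables (K : fieldType) (n : nat).

Definition lin_ext_fun (e : nat -> Pn n K) (f : Pn n K) : Pn n K :=
  \sum_(p < n.+1) f`_p *: e p.

Fact lin_ext_fun_linear (e : nat -> Pn n K) : linear (lin_ext_fun e).
Proof.
move=> a f g; rewrite /lin_ext_fun scaler_sumr -big_split /=.
by apply: eq_bigr => p _; rewrite coefD coefZ scalerDl scalerA.
Qed.

HB.instance Definition _ (e : nat -> Pn n K) :=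
  GRing.isLinear.Build K (Pn n K) (Pn n K) *:%R (lin_ext_fun e)
    (lin_ext_fun_linear e).

(* The operator 'X^p |-> e p (p = 0, ..., n) on P_n. *)
Definition lin_ext (e : nat -> Pn n K) : 'End(Pn n K) := linfun (lin_ext_fun e).

Lemma lin_extX (e : nat -> Pn n K) p :
  (p <= n)%N -> lin_ext e (npolyp n.+1 'X^p) = e p.
Proof.
move=> lepn; rewrite lfunE /= /lin_ext_fun.
rewrite (bigD1 (inord p)) //= big1 => [|i neip].
  by rewrite inordK ?ltnS // coef_npolyp ltnS lepn coefXn eqxx scale1r addr0.
rewrite coef_npolyp ltn_ord coefXn; case: eqP => [eip|]; last by rewrite scale0r.
by case/eqP: neip; apply: val_inj; rewrite /= inordK ?ltnS.
Qed.

(* Formal power series are represented by their coefficient sequences. *)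
Definition fps_mul (a b : nat -> K) (k : nat) : K :=
  \sum_(i < k.+1) a i * b (k - i)%N.

(* (1 - x)^(2n+1) * \sum_(m >= 0) m^p 'C(m + n, n) x^m; here 0 ^+ 0 = 1. *)
Definition F_series (p : nat) : nat -> K :=
  fps_mul (fun i => ((1 - 'X) ^+ (2 * n).+1 : {poly K})`_i)
          (fun m => m%:R ^+ p * 'C(m + n, n)%:R).

(* The polynomial [mk_npoly n.+1 (F_series p)] only records the coefficients of
   index <= n; by F_op_coef below, the others vanish when p <= n. *)
Definition F_op : 'End(Pn n K) :=
  lin_ext (fun p => mk_npoly n.+1 (F_series p)).

Definition shift_fun (c : K) (f : Pn n K) : Pn n K :=
  npolyp n.+1 (f \Po ('X + c%:P)).

(* No truncation takes place in shift_fun. *)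
Lemma shift_funE (c : K) (f : Pn n K) :
  shift_fun c f = f \Po ('X + c%:P) :> {poly K}.
Proof.
by rewrite npolypK // size_comp_poly2 ?size_XaddC.
Qed.

Fact shift_fun_linear (c : K) : linear (shift_fun c).
Proof.
move=> a f g; apply: val_inj; rewrite /= shift_funE /=.
by rewrite comp_polyD comp_polyZ -!shift_funE.
Qed.

HB.instance Definition _ (c : K) :=
  GRing.isLinear.Build K (Pn n K) (Pn n K) *:%R (shift_fun c)
    (shift_fun_linear c).

Definition E_op (c : K) : 'End(Pn n K) := linfun (shift_fun c).

Lemma E_opE (c : K) (f : Pn n K) : E_op c f = f \Po ('X + c%:P) :> {poly K}.
Proof. by rewrite lfunE /= shift_funE. Qed.

Definition J_op : 'End(Pn n K) := lin_ext (fun p => npolyp n.+1 'X^(n - p)).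

(* By F_op_inj below, F_op is injective, hence bijective, over a numFieldType;
   so F_op^-1 is then its two-sided inverse. *)
Definition H_op (beta : K) : 'End(Pn n K) :=
  (F_op \o E_op (n%:R * beta) \o F_op^-1)%VF.

End Operators.

Section FProperties.
Variables (K : numFieldType) (n : nat).

Let diff N (g : K -> K) (x : K) : K :=
  \sum_(i < N.+1) ((1 - 'X) ^+ N : {poly K})`_i * g (x - i%:R).

Let size_1BX N : size ((1 - 'X) ^+ N : {poly K}) = N.+1.
Proof.
have -> : (1 - 'X : {poly K}) = - ('X - 1%:P) by rewrite opprB.
by rewrite exprNn size_Msign size_exp_XsubC.
Qed.

Let diffS N g x : diff N.+1 g x = diff N (fun y => g y - g (y - 1)) x.
Proof.
rewrite /diff exprSr.
under eq_bigr => i _ do rewrite mulrBr mulr1 coefB coefMX mulrBl.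
rewrite sumrB big_ord_recr /=.
rewrite [((1 - 'X) ^+ N)`_N.+1]nth_default ?size_1BX // mul0r addr0.
rewrite [in X in _ - X]big_ord_recl /= mul0r add0r -sumrB.
apply: eq_bigr => i _; rewrite /bump /= add1n /= -mulrBr; congr (_ * (_ - g _)).
by rewrite -natr1 opprD addrA.
Qed.

Let eq_diff N g h x : g =1 h -> diff N g x = diff N h x.
Proof. by move=> gh; apply: eq_bigr => i _; rewrite gh. Qed.

Let size_diff (Q : {poly K}) N :
  (size Q <= N.+1)%N -> (size (Q - (Q \Po ('X - 1%:P)))%R <= N)%N.
Proof.
move=> sQ; apply/leq_sizeP => j; rewrite leq_eqVlt => /orP[/eqP<-|ltNj]; rewrite coefB.
  have szE := size_comp_poly2 Q (size_XsubC (1 : K)).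
  move: sQ; rewrite leq_eqVlt => /orP[/eqP sQ|sQ]; last first.
    by rewrite !nth_default ?subrr ?szE.
  have := @lead_coef_comp _ Q ('X - 1%:P).
  rewrite size_XsubC lead_coefXsubC expr1n mulr1 /lead_coef szE sQ /=.
  by move=> ->; rewrite ?subrr.
rewrite !nth_default ?subrr ?(leq_trans sQ) //.
by rewrite size_comp_poly2 ?size_XsubC // (leq_trans sQ).
Qed.

Let diff_poly N (Q : {poly K}) x :
  (size Q <= N)%N -> diff N (horner Q) x = 0.
Proof.
elim: N Q x => [|N IHN] Q x sQ.
  move: sQ; rewrite leqn0 size_poly_eq0 => /eqP->.
  by rewrite /diff big1 // => i _; rewrite horner0 mulr0.
rewrite diffS -[RHS](IHN _ x (size_diff sQ)); apply: eq_diff => y.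
by rewrite !hornerE horner_comp !hornerE.
Qed.

Let Q (p : nat) : {poly K} :=
  (n`!%:R)^-1 *: ('X^p * \prod_(j < n) ('X - (- j.+1%:R)%:P)).

Let size_Q p : (size (Q p) <= (p + n).+1)%N.
Proof.
rewrite (leq_trans (size_scale_leq _ _)) // (leq_trans (size_polyMleq _ _)) //.
by rewrite size_polyXn size_prod_XsubC /= -sum1_size sum1_card card_ord addnS.
Qed.

Let Q_bin p m : (Q p).[m%:R] = m%:R ^+ p * 'C(m + n, n)%:R.
Proof.
have nf0 : n`!%:R != 0 :> K by rewrite pnatr_eq0 -lt0n fact_gt0.
rewrite /Q hornerZ hornerM hornerXn mulrCA; congr (_ * _).
apply: (mulfI nf0); rewrite mulVKf // -natrM mulnC bin_ffact.
rewrite horner_prod ffact_prod natr_prod (reindex_inj rev_ord_inj) /=.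
apply: eq_bigr => i _; rewrite hornerXsubC opprK -natrD; congr _%:R.
by have := ltn_ord i; lia.
Qed.

Let Q_root p j : (0 < j <= n)%N -> (Q p).[- j%:R] = 0.
Proof.
case: j => // j /= ltjn; rewrite /Q hornerZ hornerM horner_prod.
by rewrite (bigD1 (Ordinal ltjn)) //= hornerXsubC subrr mul0r !mulr0.
Qed.

Lemma F_series_eq0 p k : (p <= n)%N -> (n < k)%N -> F_series K n p k = 0.
Proof.
move=> lepn ltnk.
have sQ : (size (Q p) <= (2 * n).+1)%N.
  by rewrite (leq_trans (size_Q p)) // ltnS mul2n -addnn leq_add2r.
rewrite -(diff_poly k%:R sQ) /diff /F_series /fps_mul.
set a := (1 - 'X) ^+ _.
pose G i := a`_i * (Q p).[k%:R - i%:R].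
transitivity (\sum_(i < k.+1 + (2 * n).+2) G i); last first.
  rewrite addnC big_split_ord /= [X in _ + X]big1 ?addr0 // => i _.
  by rewrite /G nth_default ?mul0r // size_1BX leq_addr.
rewrite big_split_ord /= [X in _ = _ + X]big1 ?addr0; last first.
  move=> i _; rewrite /G; have [lt2n|le2n] := ltnP (2 * n).+1 (k.+1 + i).
    by rewrite nth_default ?mul0r // size_1BX.
  have -> : k%:R - (k.+1 + i)%:R = - i.+1%:R :> K.
    by rewrite addSnnS natrD opprD addrA subrr add0r.
  by rewrite Q_root ?mulr0 //; lia.
apply: eq_bigr => i _; rewrite /G -natrB ?Q_bin //.
by rewrite -ltnS.
Qed.

(* F_op 'X^p is (1 - x)^(2n+1) * \sum_(m >= 0) m^p 'C(m + n, n) x^m. *)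
Lemma F_op_coef p k :
  (p <= n)%N -> (F_op K n (npolyp n.+1 'X^p))`_k = F_series K n p k.
Proof.
move=> lepn; rewrite lin_extX // coef_poly ltnS; case: leqP => // ltnk.
by rewrite F_series_eq0.
Qed.

Lemma F_op_inj : lker (F_op K n) == 0%VS.
Proof.
apply/lker0P; apply: raddf_inj => f Ff0.
pose a := ((1 - 'X) ^+ (2 * n).+1 : {poly K}).
have Fk k : fps_mul (fun i => a`_i) (fun m => f.[m%:R] * 'C(m + n, n)%:R) k = 0.
  transitivity ((F_op K n f)`_k); last by rewrite Ff0 coef0.
  rewrite lfunE /= /lin_ext_fun coefn_sum.
  under [RHS]eq_bigr => p _.
    have lepn : (p <= n)%N by rewrite -ltnS.
    have := F_op_coef k lepn; rewrite lin_extX // => Ep.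
    rewrite coefZ Ep /F_series /fps_mul mulr_sumr.
    over.
  rewrite exchange_big; apply: eq_bigr => i _ /=.
  rewrite (horner_coef_wide _ (size_npoly f)) mulr_suml mulr_sumr.
  by apply: eq_bigr => p _; rewrite mulrCA -!mulrA; congr (_ * _); rewrite mulrCA.
have fk k : f.[k%:R] = 0.
  elim/ltn_ind: k => k IHk; move: (Fk k); rewrite /fps_mul big_ord_recl /= subn0.
  rewrite big1 ?addr0 => [/eqP|i _]; last first.
    by rewrite IHk ?mul0r ?mulr0 // /bump /=; have := ltn_ord i; lia.
  have -> : a`_0 = 1 by rewrite -horner_coef0 horner_exp !hornerE ?oppr0 ?addr0 ?expr1n.
  rewrite mul1r mulf_eq0 pnatr_eq0.
  by rewrite eqn0Ngt bin_gt0 leq_addl orbF => /eqP.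
apply: val_inj; apply/eqP; apply: contraT => /= f0.
have rf : all (root f) [seq k%:R | k <- iota 0 n.+1].
  by apply/allP => _ /mapP[k _ ->]; rewrite /root fk.
have := max_poly_roots f0 rf; rewrite size_map size_iota ltnNge size_npoly.
apply; rewrite map_inj_uniq ?iota_uniq // => x y /eqP.
by rewrite eqr_nat => /eqP.
Qed.

End FProperties.

(* Main.v *)
Require Import Defs.
From HB Require Import structures.
From mathcomp Require Import all_boot all_order all_algebra reals complex.
From mathcomp Require Import zify ring.
Import GRing.Theory.
Local Open Scope ring_scope.

(* The polynomials G_p = (x)_p [x+n+1]_(n-p) satisfy F_n G_p = (2n)!/n! x^p, since
   G_p(m) 'C(m+n, n) n! = (2n)! 'C(m-p+2n, 2n) and the binomials 'C(k+N, N) are the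
   coefficients of (1-x)^-(N+1).  The reflection S : f(x) |-> (-1)^n f(-n-1-x)
   exchanges G_p and G_(n-p), so that S F_n^-1 = F_n^-1 J_n; as S E^c S = E^(-c),
   conjugating by F_n gives the result. *)

Section Convolution.
Variable K : comNzRingType.

(** Cutting [b] off above degree [k] leaves the coefficient of index [k] unchanged, so convolutions
    inherit the ring laws of polynomials. *)
Lemma fps_mul_poly (P : {poly K}) (b : nat -> K) k :
  \sum_(i < k.+1) P`_i * b (k - i)%N = (P * \poly_(i < k.+1) b i)`_k.
Proof.
rewrite coefM; apply: eq_bigr => i _.
by rewrite coef_poly ltnS leq_subr.
Qed.

(** The factor [1 - 'X] moves from [P] onto the series, where it acts as a backward difference with
    the value 0 before index 0. *)
Lemma fps_mul_1BX (P : {poly K}) (b : nat -> K) k :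
  \sum_(i < k.+1) ((1 - 'X) * P)`_i * b (k - i)%N =
  \sum_(i < k.+1) P`_i * (fun j => b j - (if j is j'.+1 then b j' else 0)) (k - i)%N.
Proof.
rewrite !fps_mul_poly [(1 - 'X) * P]mulrC -mulrA !coefM.
apply: eq_bigr => i _; congr (_ * _).
rewrite mulrBl mul1r coefB coefXM !coef_poly ltnS leq_subr.
by case: (k - i)%N (leq_subr i k) => //= j ltjk; rewrite ltnS (ltnW ltjk).
Qed.

(* (1 - x)^(N+1) * \sum_(m >= p) 'C(m - p + N, N) x^m = x^p *)
Lemma fps_mul_1BX_bin N p k :
  \sum_(i < k.+1) ((1 - 'X) ^+ N.+1 : {poly K})`_i *
    (if (p <= k - i)%N then 'C(k - i - p + N, N)%:R else 0) = (k == p)%:R.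
Proof.
elim: N => [|N <-]; rewrite exprS.
  (* For [N = 0] the series is the indicator of [p <= j], whose backward difference is the indicator
     of [j = p]. *)
  rewrite (fps_mul_1BX _ (fun j => if (p <= j)%N then 'C(j - p + 0, 0)%:R else 0)).
  rewrite big_ord_recl /= big1 ?addr0 => [|i _]; last first.
    by rewrite expr0 coef1 mul0r.
  rewrite expr0 coef1 mul1r subn0.
  case: k => [|k]; first by rewrite leqn0 eq_sym; case: eqP; rewrite ?bin0 subr0.
  rewrite !bin0; have [<-|nekp] := eqVneq k.+1 p.
    by rewrite leqnn ltnn subr0.
  have -> : (p <= k.+1)%N = (p <= k)%N by lia.
  by rewrite subrr.
rewrite (fps_mul_1BX _ (fun j => if (p <= j)%N then 'C(j - p + N.+1, N.+1)%:R else 0)).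
apply: eq_bigr => i _; congr (_ * _).
case: (k - i)%N => [|j] /=.
  by case: leqP => // lep; rewrite !subr0 // !sub0n !binn.
(* Pascal's rule gives the difference beyond [p]; at [p] itself the preceding term is 0 and both
   binomials are 1. *)
have [ltpj|ltjp|->] := ltngtP p j.+1.
- have -> : (p <= j)%N by lia.
  have -> : (j.+1 - p + N.+1 = (j - p + N.+1).+1)%N by lia.
  by rewrite binS natrD addrAC subrr add0r; congr 'C(_, _)%:R; lia.
- by rewrite leqNgt ltnW // subrr.
- by rewrite ltnn subr0 !subnn !binn.
Qed.

End Convolution.

(** For [p <= m] both sides equal [(m + 2n - p)! / (m - p)!]; for [m < p] both vanish. *)
Lemma ffact_reflect n p m : (p <= n)%N ->
  (m ^_ p * (m + 2 * n - p) ^_ (n - p) * 'C(m + n, n) * n`! =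
   (if p <= m then 'C(m - p + 2 * n, 2 * n) else 0) * (2 * n)`!)%N.
Proof.
move=> lepn; case: leqP => [lepm|ltmp]; last by rewrite ffact_small.
apply/eqP; rewrite -(eqn_pmul2r (fact_gt0 (m - p))); apply/eqP.
rewrite -[X in (X * _)%N]mulnA bin_ffact.
transitivity ((m + 2 * n - p)`!).
  have /ffact_fact <- : (n - p <= m + 2 * n - p)%N by lia.
  have -> : (m + 2 * n - p - (n - p) = m + n)%N by lia.
  have /ffact_fact <- : (n <= m + n)%N by lia.
  rewrite addnK -(ffact_fact lepm); ring.
rewrite bin_ffact.
have -> : (m + 2 * n - p = m - p + 2 * n)%N by lia.
by rewrite -(ffact_fact (leq_addl (m - p) (2 * n))) addnK.
Qed.

Section Reflection.
Import Num.Theory.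
Variables (K : numFieldType) (n : nat).

Implicit Types f g : Pn n K.

Lemma npoly_sumX f : f = \sum_(p < n.+1) f`_p *: npolyp n.+1 'X^p.
Proof.
apply: val_inj; rewrite /= -[LHS]coefK.
rewrite (poly_def (size f)) raddf_sum /=.
rewrite (big_ord_widen _ (fun i => f`_i *: 'X^i) (size_npoly f)) big_mkcond /=.
apply: eq_bigr => p _; rewrite npolypK ?size_polyXn //.
by case: ltnP => // /leq_sizeP ->; rewrite ?scale0r.
Qed.

Lemma npoly_lfunP (u v : 'End(Pn n K)) :
  (forall p, (p <= n)%N -> u (npolyp n.+1 'X^p) = v (npolyp n.+1 'X^p)) -> u = v.
Proof.
move=> uv; apply/lfunP => f; rewrite [f]npoly_sumX !linear_sum.
by apply: eq_bigr => p _; rewrite !linearZ /= uv // -ltnS.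
Qed.

(** Linearity turns the powers [m^p] into values [f(m)], so [F_op] can be computed on products
    without expanding them. *)
Lemma F_opE f k : (k <= n)%N ->
  (F_op K n f)`_k = \sum_(i < k.+1) ((1 - 'X) ^+ (2 * n).+1 : {poly K})`_i *
    (f.[(k - i)%:R] * 'C(k - i + n, n)%:R).
Proof.
move=> lekn; rewrite lfunE /= /lin_ext_fun coefn_sum.
under [LHS]eq_bigr => p _ do rewrite coefZ coef_poly ltnS lekn mulr_sumr.
rewrite exchange_big; apply: eq_bigr => i _ /=.
rewrite (horner_coef_wide _ (size_npoly f)) mulr_suml mulr_sumr.
by apply: eq_bigr => p _; ring.
Qed.

Definition G_poly p : {poly K} :=
  (\prod_(i < p) ('X - i%:R%:P)) * \prod_(i < n - p) ('X + (n.+1 + i)%:R%:P).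

Lemma size_G_poly p : (p <= n)%N -> (size (G_poly p) <= n.+1)%N.
Proof.
move=> lepn; rewrite (leq_trans (size_polyMleq _ _)) //.
under [X in (_ + size (polyseq X))%N]eq_bigr => i _ do
  rewrite -[_%:P]opprK -polyCN.
rewrite !size_prod_XsubC /= -!sum1_size !sum1_card !card_ord; lia.
Qed.

Lemma horner_G_poly p m : (p <= n)%N ->
  (G_poly p).[m%:R] = (m ^_ p * (m + 2 * n - p) ^_ (n - p))%:R.
Proof.
move=> lepn; rewrite hornerM !horner_prod natrM; congr (_ * _).
  have [lepm|ltmp] := leqP p m.
    rewrite ffact_prod natr_prod; apply: eq_bigr => i _.
    by rewrite hornerXsubC natrB // ltnW // (leq_trans (ltn_ord i)).
  by rewrite ffact_small // (bigD1 (Ordinal ltmp)) //= hornerXsubC subrr mul0r.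
(* The rising product from [m + n + 1] to [m + 2n - p], read backwards, is a falling factorial. *)
rewrite ffact_prod natr_prod (reindex_inj rev_ord_inj) /=.
apply: eq_bigr => i _; rewrite hornerD hornerX hornerC -natrD; congr _%:R.
by have := ltn_ord i; lia.
Qed.

Lemma F_op_G p : (p <= n)%N ->
  F_op K n (npolyp n.+1 (G_poly p)) =
  ((2 * n)`!%:R / n`!%:R) *: npolyp n.+1 'X^p.
Proof.
move=> lepn; have nf0 : n`!%:R != 0 :> K by rewrite pnatr_eq0 -lt0n fact_gt0.
apply/npolyP => k; rewrite coefZ coef_npolyp.
have [ltnk|lekn] := ltnP n k.
  by rewrite ltnS leqNgt ltnk mulr0 nth_default ?(leq_trans (size_npoly _)).
rewrite F_opE // ltnS lekn coefXn -(fps_mul_1BX_bin K (2 * n)) mulr_sumr.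
apply: eq_bigr => i _; rewrite npolypK ?size_G_poly // horner_G_poly //.
have := congr1 (fun j => j%:R : K) (ffact_reflect n p (k - i) lepn).
rewrite natrM natrM [in X in _ = X -> _]natrM => E.
rewrite -[X in _ * X = _](mulfK nf0) E; case: ifP => _; field; exact: nf0.
Qed.

Lemma F_op_invX p : (p <= n)%N ->
  (F_op K n)^-1%VF (npolyp n.+1 'X^p) =
  (n`!%:R / (2 * n)`!%:R) *: npolyp n.+1 (G_poly p).
Proof.
move=> lepn; rewrite -[RHS](lker0_lfunK (F_op_inj K n)) linearZ /= F_op_G //.
by rewrite scalerA mulrA divfK ?divff ?scale1r // pnatr_eq0 -lt0n fact_gt0.
Qed.

(** The reflection of the line about [-(n+1)/2]; the sign compensates the sign changes of the [n]
    linear factors of [G_poly p]. *)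
Definition reflect_poly f : {poly K} := (-1) ^+ n *: (f \Po ((- n.+1%:R)%:P - 'X)).

Lemma size_reflect_poly f : (size (reflect_poly f) <= n.+1)%N.
Proof.
rewrite (leq_trans (size_scale_leq _ _)) // size_comp_poly2 //.
by rewrite -opprB size_polyN size_XsubC.
Qed.

Definition reflect_fun f : Pn n K := npolyp n.+1 (reflect_poly f).

Fact reflect_fun_linear : linear reflect_fun.
Proof.
move=> a f g; apply: val_inj; rewrite /= !npolypK ?size_reflect_poly //.
rewrite /reflect_poly /= comp_polyD comp_polyZ scalerDr !scalerA.
by rewrite [_ * a]mulrC.
Qed.

HB.instance Definition _ :=
  GRing.isLinear.Build K (Pn n K) (Pn n K) *:%R reflect_fun reflect_fun_linear.

Definition reflect_op : 'End(Pn n K) := linfun reflect_fun.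

Lemma reflect_opE f : reflect_op f = reflect_poly f :> {poly K}.
Proof. by rewrite lfunE /= npolypK ?size_reflect_poly. Qed.

(** The substitution sends [x - i] to [-(x + n + 1 + i)] and conversely, which swaps the two
    products. *)
Lemma reflect_op_G p : (p <= n)%N ->
  reflect_op (npolyp n.+1 (G_poly p)) = npolyp n.+1 (G_poly (n - p)).
Proof.
move=> lepn; apply: val_inj; rewrite /= reflect_opE /reflect_poly.
rewrite !npolypK ?size_G_poly ?leq_subr // /G_poly subKn // [in RHS]mulrC.
have -> : (-1) ^+ n = (-1) ^+ p * (-1) ^+ (n - p) :> K by rewrite -exprD subnKC.
rewrite comp_polyM !rmorph_prod /= -scalerA [_ ^+ (n - p) *: _]scalerAr scalerAl.
congr (_ * _).
  rewrite -{1}[p]card_ord -prodr_const -scaler_prod; apply: eq_bigr => i _.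
  rewrite comp_polyB comp_polyX comp_polyC scaleN1r natrD polyCD polyCN; ring.
rewrite -{1}[(n - p)%N]card_ord -prodr_const -scaler_prod; apply: eq_bigr => i _.
rewrite comp_polyD comp_polyX comp_polyC scaleN1r natrD polyCD polyCN; ring.
Qed.

Lemma reflect_F_op_inv : (reflect_op \o (F_op K n)^-1 = (F_op K n)^-1 \o J_op K n)%VF.
Proof.
apply: npoly_lfunP => p lepn; rewrite !comp_lfunE lin_extX //.
by rewrite !F_op_invX ?leq_subr // linearZ /= reflect_op_G.
Qed.

Lemma F_op_reflect : (F_op K n \o reflect_op = J_op K n \o F_op K n)%VF.
Proof.
apply/lfunP => f; rewrite !comp_lfunE /=.
have /lfunP/(_ (F_op K n f)) := reflect_F_op_inv.
rewrite !comp_lfunE lker0_lfunK ?F_op_inj // => ->.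
by rewrite lker0_lfunVK ?F_op_inj.
Qed.

(** The two signs cancel, and reflecting, shifting by [c] and reflecting back sends [x] to
    [x - c]. *)
Lemma reflect_E_op (c : K) :
  (reflect_op \o E_op n c \o reflect_op = E_op n (- c))%VF.
Proof.
apply/lfunP => f; apply: val_inj.
rewrite !comp_lfunE /= reflect_opE /reflect_poly !E_opE reflect_opE /reflect_poly.
rewrite !comp_polyZ scalerA -exprMn mulrNN mulr1 expr1n scale1r -!comp_polyA.
congr (_ \Po _).
rewrite !(comp_polyB, comp_polyD, comp_polyX, comp_polyC) !polyCN; ring.
Qed.

Lemma H_opN (beta : K) :
  H_op n (- beta) = (J_op K n \o H_op n beta \o J_op K n)%VF.
Proof.
(* With [S] the reflection, the right-hand [S] passes through the inverse of [F_op] and the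
   left-hand one through [F_op], each emerging as [J_op]. *)
rewrite /H_op mulrN -reflect_E_op -!comp_lfunA reflect_F_op_inv.
by rewrite !comp_lfunA F_op_reflect.
Qed.

End Reflection.

Theorem theorem18 (R : realType) (n : nat) (beta : R[i]) :
  H_op n (- beta) = (J_op R[i] n \o H_op n beta \o J_op R[i] n)%VF.
Proof. exact: H_opN. Qed.
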